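(* Let $(X,d,A)$ be a metric pair with $A\neq\varnothing$ such that $(X/A,\overline d_1,[A])$ is uniformly discrete, let $\psi:[0,\infty)\to[0,\infty)$ satisfy $\psi(0)=0$ and $\sum_{x,y\in X\setminus A,\,x\ne y}\psi(\overline d_1(x,y))<\infty$, and let $H$, $(p_t)_{t\ge0}$, $\nu$, $\mathcal M$, $\rho$ be as in the context. Let $(X_t)_{t\ge0}$ be the L\'evy process on $H$ with convolution semigroup $(p_t)_{t\ge0}$ and L\'evy measure $\nu$, started at $X_0=0$. Then for every $t>0$ and $R>0$, $$\mathbb P\bigl(\mathcal M(X_t)>R\bigr)\le t\,\nu\{\kappa\in H\setminus\{0\}:\mathcal M(\kappa)>R\}+\frac tR\int_{\{\kappa\in H\setminus\{0\}:\mathcal M(\kappa)\le R\}}\mathcal M(\kappa)\,d\nu(\kappa).$$ In particular, the same bound holds with $\mathcal M(X_t)$ on the left-hand side replaced by $\rho(X_t,0)$.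
   Context: Metric pair: $(X,d)$ is a metric space and $A\subseteq X$ is nonempty. Put $d(x,A)=\inf_{a\in A}d(x,a)$ and $d_1(x,y)=\min(d(x,y),d(x,A)+d(y,A))$. $X/A$ is the quotient collapsing $A$ to a basepoint $[A]$, and $\overline d_1$ is the metric on $X/A$ induced by $d_1$ (so $\overline d_1(x,y)=d_1(x,y)$ and $\overline d_1(x,[A])=d(x,A)$ for $x,y\in X\setminus A$). Uniformly discrete means: there is $c>0$ with $\overline d_1(u,v)\ge c$ for all distinct $u,v\in X/A$. $D(X,A)$ is the free commutative monoid on $X$ modulo the submonoid generated by $A$ (finite multisets in $X\setminus A$); $K(X,A)$ is its Grothendieck group, identified with $\bigoplus_{x\in X\setminus A}\mathbb Z e_x$ and regarded as a discrete abelian group. For $\alpha,\beta\in D(X,A)$, $W_1(\alpha,\beta)$ is the infimum of $\sum_i\overline d_1(u_i,v_i)$ over finite families of pairs $(u_i,v_i)\in (X/A)^2$ such that $\alpha$ is the multiset of those $u_i\neq[A]$ and $\beta$ the multiset of those $v_i\ne[A]$. The metric $\rho$ on $K(X,A)$ is $\rho(\alpha-\beta,\gamma-\delta)=W_1(\alpha+\delta,\gamma+\beta)$; it is translation invariant. The mass of $g=\sum_{u}n_ue_u\in K(X,A)$ (sum over $u\in X/A\setminus\{[A]\}$, finitely many $n_u\in\mathbb Z$ nonzero) is $\mathcal M(g)=\sum_u|n_u|\,\overline d_1(u,[A])$. For a discrete abelian group $G$, $\widehat G$ is the compact group of characters $G\to\mathbb T$; $\widehat p(\theta)=\sum_gp(g)\overline{\theta(g)}$.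 For $\theta\in\widehat{K(X,A)}$ put $\lambda^\psi(\theta)=\frac12\sum_{x,y\in X\setminus A,\,x\neq y}\psi(\overline d_1(x,y))(1-\Re\,\theta(e_x-e_y))$; $(p_t)_{t\ge0}=(p_t^\psi)_{t\ge0}$ is the unique convolution semigroup of probability measures on $K(X,A)$ with $\widehat{p_t}=e^{-t\lambda^\psi}$. With $\operatorname{supp}(p)=\{g:p(g)>0\}$, $H$ is the subgroup generated by $\bigcup_{q\in\mathbb Q_{\ge0}}\operatorname{supp}(p_q)$; it is countable and contains every $\operatorname{supp}(p_t)$. $\lambda_H:\widehat H\to[0,\infty)$ is the function with $\sum_{h\in H}p_t(h)\overline{\theta(h)}=e^{-t\lambda_H(\theta)}$ for all $t\ge0$, and $\nu$ (the L\'evy measure) is the unique nonnegative symmetric element of $\ell^1(H\setminus\{0\})$ with $\lambda_H(\theta)=\sum_{\kappa\in H\setminus\{0\}}(1-\Re\,\theta(\kappa))\nu(\kappa)$ for all $\theta\in\widehat H$, viewed also as a finite measure on $H\setminus\{0\}$. The L\'evy process $(X_t)$ has stationary independent increments, c\`adl\`ag paths, and $X_t$ has law $p_t$. *)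

(* Defs.v *)
From HB Require Import structures.
From mathcomp Require Import all_boot all_order all_algebra.
From mathcomp Require Import finmap multiset freeg complex zify ring lra.
From mathcomp Require Import all_classical all_reals all_analysis.

Set Implicit Arguments.
Unset Strict Implicit.
Unset Printing Implicit Defensive.

Import Order.TTheory GRing.Theory Num.Theory numFieldNormedType.Exports.

Local Open Scope classical_set_scope.
Local Open Scope ring_scope.
Local Open Scope complex_scope.

Section metric_pair.
Context {R : realType} {X : metricType R}.
Implicit Types (A : set X) (x y : X).

Definition dist_to A x : R := inf [set mdist x a | a in A].

Definition d1 A x y : R :=
  Num.min (mdist x y) (dist_to A x + dist_to A y).

(* X/A: [Some u] is the class of the point u outside A, [None] is [A]. *)
Definition quot A : Type := option (~` A).

HB.instance Definition _ A := Choice.on (quot A).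

Definition quot_proj A x : quot A := insub x.

Definition d1bar A (u v : quot A) : R :=
  match u, v with
  | Some x, Some y => d1 A (val x) (val y)
  | Some x, None => dist_to A (val x)
  | None, Some y => dist_to A (val y)
  | None, None => 0
  end.

Definition uniformly_discrete A : Prop :=
  exists2 c : R, 0 < c & forall u v : quot A, u != v -> c <= d1bar u v.

Definition Dmon A : Type := {mset (~` A)}%mset.

(* The families (u_i, v_i) are sequences of pairs; [pmap id] drops the
   entries equal to the basepoint. *)
Definition matching A (a b : Dmon A) (s : seq (quot A * quot A)) : Prop :=
  seq_mset (pmap id (unzip1 s)) = a /\ seq_mset (pmap id (unzip2 s)) = b.

Definition W1 A (a b : Dmon A) : R :=
  inf [set \sum_(z <- s) d1bar z.1 z.2 | s in matching a b].

Definition Kgrp A : Type := {freeg (~` A)}.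

HB.instance Definition _ A := GRing.Zmodule.on (Kgrp A).
HB.instance Definition _ A := isPointed.Build (Kgrp A) 0.
HB.instance Definition _ A := @isMeasurable.Build default_measure_display
  (Kgrp A) discrete_measurable discrete_measurable0
  discrete_measurableC discrete_measurableU.

Definition ebasis A (x : ~` A) : Kgrp A := << x >>.

Definition Kof A (a : Dmon A) : Kgrp A := \sum_(x <- enum_mset a) ebasis x.

Definition pos_part A (g : Kgrp A) : Dmon A :=
  [fsfun x in [fset y in dom g]%fset => absz (Num.max (coeff x g) 0) | 0%N].

(* [rho] is computed on the representatives g = g^+ - g^-; [rhoE] below shows
   that every other pair of representatives gives the same value. *)
Definition rho A (g h : Kgrp A) : R :=
  W1 (pos_part g `+` pos_part (- h))%mset (pos_part h `+` pos_part (- g))%mset.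

Definition mass A (g : Kgrp A) : R :=
  \sum_(u <- dom g) `|coeff u g|%:~R * d1bar (Some u) None.

End metric_pair.

Section metric_pair_theory.
Context {R : realType} {X : metricType R} {A : set X}.
Context (A0 : A !=set0).
Implicit Types (x y : X) (u v w : quot A) (a b c : Dmon A).

Lemma dist_to_has_inf x : has_inf [set mdist x a | a in A].
Proof.
split; first by have [a Aa] := A0; exists (mdist x a), a.
by exists 0 => _ [a _ <-]; exact: mdist_ge0.
Qed.

Lemma dist_to_ge0 x : 0 <= dist_to A x.
Proof.
apply: lb_le_inf; first exact: (dist_to_has_inf x).1.
by move=> _ [a _ <-]; exact: mdist_ge0.
Qed.

Lemma dist_to_le x (a : X) : A a -> dist_to A x <= mdist x a.
Proof. by move=> Aa; apply: ge_inf; [exact: (dist_to_has_inf x).2|exists a]. Qed.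

Lemma dist_to_eq0 x : A x -> dist_to A x = 0.
Proof.
move=> Ax; apply/eqP; rewrite eq_le dist_to_ge0 andbT.
by rewrite (le_trans (dist_to_le x Ax))// mdistxx.
Qed.

Lemma dist_to_triangle x y : dist_to A x <= mdist x y + dist_to A y.
Proof.
rewrite -lerBlDl; apply: lb_le_inf; first exact: (dist_to_has_inf y).1.
move=> _ [a Aa <-]; rewrite lerBlDl.
by rewrite (le_trans (dist_to_le x Aa))// metric_triangle.
Qed.

(* [d1bar] is the metric induced by [d1] through the collapse map. *)
Lemma d1barE x y : d1bar (quot_proj A x) (quot_proj A y) = d1 A x y.
Proof.
rewrite /quot_proj /d1; case: insubP => [u _ <-|]; case: insubP => [v _ <-|] //=.
- rewrite in_setC negbK inE => Ay; rewrite (dist_to_eq0 Ay) addr0.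
  by rewrite min_r// dist_to_le.
- rewrite in_setC negbK inE => Ax; rewrite (dist_to_eq0 Ax) add0r.
  by rewrite min_r// metric_sym dist_to_le.
- rewrite !in_setC !negbK !inE => Ay Ax.
  by rewrite (dist_to_eq0 Ax) (dist_to_eq0 Ay) addr0 min_r// mdist_ge0.
Qed.

Lemma quot_proj_surj u : exists x, quot_proj A x = u.
Proof.
case: u => [x|]; first by exists (val x); rewrite /quot_proj valK.
have [a Aa] := A0; exists a; rewrite /quot_proj insubF//.
by apply/negbTE; rewrite notin_setE /= => /(_ Aa).
Qed.

Lemma quot_projP x y :
  quot_proj A x = quot_proj A y <-> x = y \/ A x /\ A y.
Proof.
rewrite /quot_proj; case: insubP => [u + ux|]; case: insubP => [v + vy|].
- rewrite !inE => Ay Ax; split => [[uv]|[xy|[]//]].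
    by left; rewrite -ux -vy uv.
  by congr Some; apply: val_inj; rewrite ux vy xy.
- rewrite !in_setC negbK !inE => Ay; rewrite notin_setE => nAx; split => // -[xy|[]//].
  by move: nAx; rewrite xy.
- rewrite !in_setC negbK !inE notin_setE => nAy Ax; split => // -[xy|[]//].
  by move: nAy; rewrite -xy.
- by rewrite !in_setC !negbK !inE => Ay Ax; split => // _; right.
Qed.

Lemma d1_triangle x y z : d1 A x z <= d1 A x y + d1 A y z.
Proof.
rewrite /d1.
have := metric_triangle x y z; have := dist_to_triangle x y.
have := dist_to_triangle y x; have := dist_to_triangle z y.
have := dist_to_triangle y z; have := dist_to_ge0 y.
rewrite (metric_sym y x) (metric_sym z y).
have := mdist_ge0 x y; have := mdist_ge0 y z.
by rewrite !minElt; do ![case: ifPn; rewrite ?ltNge ?negbK => ?]; lra.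
Qed.

Lemma d1bar_triangle u v w : d1bar u w <= d1bar u v + d1bar v w.
Proof.
have [x <-] := quot_proj_surj u; have [y <-] := quot_proj_surj v.
by have [z <-] := quot_proj_surj w; rewrite !d1barE d1_triangle.
Qed.

Lemma d1bar_ge0 u v : 0 <= d1bar u v.
Proof.
have [x <-] := quot_proj_surj u; have [y <-] := quot_proj_surj v.
by rewrite d1barE /d1 le_min mdist_ge0 addr_ge0 ?dist_to_ge0.
Qed.

Lemma d1barxx u : d1bar u u = 0.
Proof.
have [x <-] := quot_proj_surj u.
by rewrite d1barE /d1 mdistxx min_l// addr_ge0 ?dist_to_ge0.
Qed.

Lemma pmap_None (T U : Type) (s : seq U) :
  pmap id [seq (None : option T) | _ <- s] = [::].
Proof. by elim: s. Qed.

Lemma pmap_Some (T : Type) (s : seq T) : pmap id (map Some s) = s.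
Proof. by elim: s => //= z s ->. Qed.

Lemma matching_exists a b : exists s, matching a b s.
Proof.
exists (map (fun z => (Some z, None)) (enum_mset a) ++
        map (fun z => (None, Some z)) (enum_mset b)).
rewrite /matching /unzip1 /unzip2 !map_cat -!map_comp !pmap_cat.
by rewrite !pmap_None !pmap_Some cats0 !seq_mset_id.
Qed.

Let cost (s : seq (quot A * quot A)) : R := \sum_(z <- s) d1bar z.1 z.2.

Lemma W1_has_inf a b : has_inf [set cost s | s in matching a b].
Proof.
split; first by have [s ms] := matching_exists a b; exists (cost s), s.
by exists 0 => _ [s _ <-]; apply: sumr_ge0 => z _; exact: d1bar_ge0.
Qed.

Lemma matching_perm a b s s' : perm_eq s s' -> matching a b s -> matching a b s'.
Proof.
move=> ss' [<- <-]; split; apply/eq_seq_msetP; rewrite perm_sym;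
  exact/perm_pmap/perm_map.
Qed.

Lemma matching_consl a b (x : ~` A) v s : matching (x +` a)%mset b ((Some x, v) :: s) ->
  seq_mset (pmap id (unzip1 s)) = a.
Proof.
move=> [+ _] /=; move=> e; apply/msetP => y; move/msetP/(_ y): e.
by rewrite !mset_seqE mset1DE /= [y == x]eq_sym => /addnI.
Qed.

Lemma matching_cancel1 (x : ~` A) a b s : matching (x +` a)%mset (x +` b)%mset s ->
  exists2 s', matching a b s' & cost s' <= cost s.
Proof.
move=> m.
have : x \in pmap id (unzip1 s).
  by rewrite -(perm_mem (perm_eq_seq_mset _)) m.1 in_mset1D eqxx.
rewrite -[x \in _]/(x \in (pmap id (unzip1 s) : seq (~` A))).
rewrite mem_pmap map_id => /mapP[[u v] zs /= xu].
have ps := perm_to_rem zs; move: (rem _ s) ps => s1 ps.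
rewrite /cost (perm_big _ ps) big_cons /=; have {}m := matching_perm ps m.
move: m; rewrite -xu => {zs ps s u xu} m.
have m1 := matching_consl m.
have [vx|vx] := eqVneq v (Some x).
  exists s1; last by rewrite lerDr d1bar_ge0.
  split => //; apply/msetP => y; move: m => [_ /msetP/(_ y)].
  by rewrite vx /= !mset_seqE mset1DE /= [y == x]eq_sym => /addnI.
have : x \in pmap id (unzip2 ((Some x, v) :: s1)).
  by rewrite -(perm_mem (perm_eq_seq_mset _)) m.2 in_mset1D eqxx.
rewrite mem_pmap map_id /= in_cons eq_sym (negbTE vx) /= => /mapP[[u w] zs /= xw].
have ps := perm_to_rem zs; move: (rem _ s1) ps => s2 ps.
exists ((u, v) :: s2); last first.
  rewrite (perm_big _ ps) !big_cons /= addrA lerD2r -xw addrC.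
  exact: d1bar_triangle.
split.
  rewrite -m1; apply/eq_seq_msetP; rewrite perm_sym.
  exact: (perm_pmap id (perm_map fst ps)).
have m2 := matching_perm (_ : perm_eq _ ((Some x, v) :: (u, w) :: s2)) m.
have {m2}[_ +] := m2 ltac:(by rewrite perm_cons).
rewrite -xw /= => /msetP e; apply/msetP => y; move: (e y).
case: v {m vx e} => [v|] /=; rewrite !mset_seqE mset1DE /= [y == x]eq_sym.
  by rewrite addnCA => /addnI.
by move=> /addnI.
Qed.

Lemma W1_cancel1 (x : ~` A) a b : W1 (x +` a)%mset (x +` b)%mset = W1 a b.
Proof.
apply/eqP; rewrite eq_le; apply/andP; split.
  apply: lb_le_inf; first exact: (W1_has_inf a b).1.
  move=> _ [s [m1 m2] <-]; apply: ge_inf; first exact: (W1_has_inf _ _).2.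
  exists ((Some x, Some x) :: s); last by rewrite /cost big_cons (d1barxx (Some x)) add0r.
  split; apply/msetP => y; rewrite mset1DE mset_seqE /= eq_sym.
    by rewrite -m1 mset_seqE.
  by rewrite -m2 mset_seqE.
apply: lb_le_inf; first exact: (W1_has_inf _ _).1.
move=> _ [s m <-]; have [s' m' le] := matching_cancel1 m.
by apply: le_trans le; apply: ge_inf; [exact: (W1_has_inf _ _).2|exists s'].
Qed.

Lemma W1_cancel c a b : W1 (c `+` a)%mset (c `+` b)%mset = W1 a b.
Proof.
rewrite -(seq_mset_id c); elim: (enum_mset c) => [|x s IH].
  by congr W1; apply/msetP => y; rewrite msetE2 mset_seqE.
rewrite -IH -[RHS](W1_cancel1 x).
by congr W1; apply/msetP => y; rewrite mset1DE !msetE2 !mset_seqE /= [y == x]eq_sym addnA.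
Qed.

Lemma coeff_Kof a (y : ~` A) : coeff y (Kof a) = (a y)%:Z.
Proof.
rewrite -{2}(seq_mset_id a) mset_seqE /Kof.
elim: (enum_mset a) => [|x s IH]; first by rewrite big_nil coeff0.
rewrite big_cons coeffD IH coeffU mul1r /=; lia.
Qed.

Lemma pos_partE (g : Kgrp A) (y : ~` A) : (pos_part g y)%:Z = Num.max (coeff y g) 0.
Proof.
rewrite /pos_part fsfunE !inE /=.
case: ifPn => yg; first lia.
by rewrite coeff_outdom.
Qed.

Lemma rhoE a b c d :
  rho (Kof a - Kof b) (Kof c - Kof d) = W1 (a `+` d)%mset (c `+` b)%mset.
Proof.
rewrite /rho; set g := Kof a - Kof b; set h := Kof c - Kof d.
rewrite -(W1_cancel (b `+` d)%mset) -[RHS](W1_cancel (pos_part (- g) `+` pos_part (- h))%mset).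
congr W1; apply/msetP => y; rewrite !msetE2;
  have := pos_partE g y; have := pos_partE (- g) y;
  have := pos_partE h y; have := pos_partE (- h) y;
  rewrite /g /h !(coeffN, coeffB, coeffD) !coeff_Kof; lia.
Qed.

Lemma Kof_surj (g : Kgrp A) : exists a b, g = Kof a - Kof b.
Proof.
exists (pos_part g), (pos_part (- g)); apply/eqP/freeg_eqP => y.
have := pos_partE g y; have := pos_partE (- g) y.
by rewrite !(coeffN, coeffB, coeffD) !coeff_Kof; lia.
Qed.

End metric_pair_theory.

Section sums.
Context {R : realType} {T : choiceType}.

(* Meaningful for absolutely summable families. *)
Definition rsum (D : set T) (f : T -> R) : R :=
  fine (\esum_(x in D) (f^\+ x)%:E) - fine (\esum_(x in D) (f^\- x)%:E).

Definition csum (D : set T) (f : T -> R[i]) : R[i] :=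
  rsum D (fun x => complex.Re (f x)) +i* rsum D (fun x => complex.Im (f x)).

End sums.

Section weights.
Context {R : realType} {X : metricType R} {A : set X}.
Local Notation K := (Kgrp A).
Implicit Types (p f : K -> {nonneg R}) (D H : set K) (theta : K -> R[i]).

Definition weighted f (B : set K) : \bar R := (\esum_(k in B) (f k)%:num%:E)%E.

Let weighted0 f : weighted f set0 = 0%E.
Proof. exact: esum_set0. Qed.

Let weighted_ge0 f B : (0 <= weighted f B)%E.
Proof. by apply: esum_ge0 => k _; rewrite lee_fin. Qed.

Let weighted_sigma_additive f : semi_sigma_additive (weighted f).
Proof.
move=> F _ tF _; rewrite /weighted esum_bigcupT//.
rewrite -nneseries_esumT//; last by move=> n; exact: weighted_ge0.
by apply: is_cvg_nneseries => n _ _; exact: weighted_ge0.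
Qed.

HB.instance Definition _ f := isMeasure.Build _ _ _ (weighted f)
  (weighted0 f) (weighted_ge0 f) (@weighted_sigma_additive f).

Definition supp p : set K := [set g | 0 < (p g)%:num].

Definition is_subgroup H : Prop :=
  H 0 /\ forall g h, H g -> H h -> H (g - h).

(* A character of the subgroup H is any function on K whose restriction to H
   is one; only the values on H are ever used. *)
Definition is_character H theta : Prop :=
  forall g h, H g -> H h ->
    theta (g + h) = theta g * theta h /\ `|theta g| = 1.

Definition fourier D p theta : R[i] :=
  csum D (fun g => (p g)%:num%:C * Num.conj (theta g)).

Definition lambda_psi (psi : R -> R) theta : R :=
  2^-1 * fine (\esum_(z in [set z : ~` A * ~` A | z.1 != z.2])
    (psi (d1bar (Some z.1) (Some z.2)) *
     (1 - complex.Re (theta (ebasis z.1 - ebasis z.2))))%:E)%E.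

Definition convolution_semigroup (p : R -> K -> {nonneg R}) : Prop :=
  [/\ forall t : R, 0 <= t -> weighted (p t) setT = 1%E,
      forall g, (p 0 g)%:num = (g == 0)%:R
    & forall (s t : R) g, 0 <= s -> 0 <= t ->
        ((p (s + t) g)%:num%:E =
         \esum_(h in setT) ((p s h)%:num * (p t (g - h))%:num)%:E)%E].

Definition psi_semigroup (psi : R -> R) (p : R -> K -> {nonneg R}) : Prop :=
  convolution_semigroup p /\
  forall (t : R) theta, 0 <= t -> is_character setT theta ->
    fourier setT (p t) theta = (expR (- t * lambda_psi psi theta))%:C.

Definition Hgrp (p : R -> K -> {nonneg R}) : set K :=
  smallest is_subgroup
    (\bigcup_(q in [set q : rat | 0 <= q]) supp (p (ratr q))).

Definition is_exponent (H : set K) (p : R -> K -> {nonneg R})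
    (lambdaH : (K -> R[i]) -> R) : Prop :=
  forall theta, is_character H theta ->
    0 <= lambdaH theta /\
    forall t : R, 0 <= t -> fourier H (p t) theta = (expR (- t * lambdaH theta))%:C.

Definition pierced H : set K := H `\ 0.

Definition is_levy_measure (H : set K) (lambdaH : (K -> R[i]) -> R)
    (nu : K -> {nonneg R}) : Prop :=
  [/\ (weighted nu (pierced H) < +oo)%E,
      forall k, pierced H k -> nu (- k) = nu k
    & forall theta, is_character H theta ->
        ((lambdaH theta)%:E = \esum_(k in pierced H)
          ((1 - complex.Re (theta k)) * (nu k)%:num)%:E)%E].

Section process.
Context {d : measure_display} {Omega : measurableType d}.
Context (P : probability Omega R).

Definition mutually_independent n (Y : 'I_n -> Omega -> K) : Prop :=
  forall B : 'I_n -> set K,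
    P (\bigcap_(i in [set: 'I_n]) (Y i @^-1` B i)) =
    (\prod_(i < n) P (Y i @^-1` B i))%E.

(* Right continuity and left limits are for the discrete topology of H, in
   which convergence means being eventually constant. *)
Definition cadlag (x : R -> K) : Prop :=
  (forall t, 0 <= t -> \forall s \near t^'+, x s = x t) /\
  (forall t, 0 < t -> exists g, \forall s \near t^'-, x s = g).

Definition levy_process (H : set K) (p : R -> K -> {nonneg R})
    (Y : R -> Omega -> K) : Prop :=
  [/\ forall t : R, 0 <= t -> measurable_fun setT (Y t) /\ forall w, H (Y t w),
      {ae P, forall w, Y 0 w = 0},
      {ae P, forall w, cadlag (fun t => Y t w)}
    & [/\ forall n (s : nat -> R), 0 <= s 0%N ->
            (forall i, (i < n)%N -> s i < s i.+1) ->
            mutually_independent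
              (fun i : 'I_n => fun w => Y (s i.+1) w - Y (s i) w),
          forall (s t : R) (B : set K), 0 <= s -> 0 <= t ->
            P ((fun w => Y (s + t) w - Y s w) @^-1` B) = P (Y t @^-1` B)
        & forall (t : R) (B : set K), 0 <= t ->
            P (Y t @^-1` B) = weighted (p t) B]].

End process.
End weights.

(* Main.v *)
(** The truncation phi := min(1, M / r) is subadditive, bounded and vanishes at 0,
and P(M(X_t) > r) <= E phi(X_t).  Since (p_t) is a convolution semigroup,
E phi(X_t) <= n E phi(X_(t/n)), so it suffices to bound E phi(X_s) by
s (sum of phi nu) + O(s^2).  This follows from |p_s(g) - s nu(g)| <= C s^2 for
g <> 0 and 1 - p_s(0) <= s nu(H \ 0) + C s^2, where C does not depend on g.

Both estimates come from averaging exp(-s lambda_H) = 1 - s lambda_H + O(s^2)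
over a finite family of characters.  For a given finite set of nonzero elements
of the free group there is such a family whose average vanishes on that set, so
averaging extracts a single coefficient of a finitely supported function; the
general case follows by letting the tails of p_s and nu tend to 0. *)

Require Import Defs.
From HB Require Import structures.
From mathcomp Require Import all_boot all_order all_algebra.
From mathcomp Require Import finmap multiset freeg complex zify ring lra.
From mathcomp Require Import all_classical all_reals all_analysis measurable_realfun.
Import Order.TTheory GRing.Theory Num.Theory numFieldNormedType.Exports.
Local Open Scope classical_set_scope.
Local Open Scope ring_scope.

(** * Approximation of infinite sums by finite partial sums *)

Section esum_tails.
Context {R : realType} {T : choiceType}.
Implicit Types (D : set T) (F : {fset T}) (u v f : T -> R).

Lemma esum_fset_split D F u : (forall x, 0 <= u x) -> [set` F] `<=` D ->
  (\esum_(x in D) (u x)%:E =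
   (\sum_(x <- F) u x)%:E + \esum_(x in D `\` [set` F]) (u x)%:E)%E.
Proof.
move=> u0 FD; rewrite (esumID [set` F]); last by move=> x _; rewrite lee_fin.
congr (_ + _)%E; rewrite setIidr// esum_fset//; last by move=> x _; rewrite lee_fin.
by rewrite fsbig_finite//= set_fsetK sumEFin.
Qed.

(** When the sum is finite, some finite partial sum comes within [e] of the supremum, which leaves
    at most [e] outside. *)
Lemma esum_tail D u e : (forall x, 0 <= u x) ->
  (\esum_(x in D) (u x)%:E < +oo)%E -> 0 < e ->
  exists2 F : {fset T}, [set` F] `<=` D &
    (\esum_(x in D `\` [set` F]) (u x)%:E <= e%:E)%E.
Proof.
move=> u0 fin e0.
have efin : (\esum_(x in D) (u x)%:E)%E \is a fin_num.
  by rewrite ge0_fin_numE// esum_ge0// => x _; rewrite lee_fin.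
have [_ [X [finX XD] <-] lt] := ub_ereal_sup_adherent e0 efin.
exists (fset_set X); rewrite ?fset_setK//.
move: lt; rewrite -[ereal_sup _]/(\esum_(x in D) (u x)%:E)%E.
rewrite fsbig_finite//= sumEFin => lt.
have := @esum_fset_split D (fset_set X) u u0.
rewrite fset_setK// => /(_ XD) E.
move: lt efin; rewrite E.
case: (\esum_(x in _ `\` _) _)%E => [y||] //=.
by rewrite -!EFinD lte_fin lee_fin => ? _; lra.
Qed.

Lemma le_esum_set D D' u : (forall x, 0 <= u x) -> D' `<=` D ->
  (\esum_(x in D') (u x)%:E <= \esum_(x in D) (u x)%:E)%E.
Proof.
move=> u0 DD; rewrite (esumID D' D)//; last by move=> x _; rewrite lee_fin.
by rewrite setIidr// leeDl// esum_ge0// => x _; rewrite lee_fin.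
Qed.

(** The tail condition concerns only the dominating [v], so one truncation serves every [u] below
    it, in particular the summands coming from all characters at once. *)
Lemma fine_esum_approx D F u v e : (forall x, 0 <= u x <= v x) ->
  [set` F] `<=` D -> (\esum_(x in D `\` [set` F]) (v x)%:E <= e%:E)%E ->
  \sum_(x <- F) u x <= fine (\esum_(x in D) (u x)%:E)%E <= \sum_(x <- F) u x + e.
Proof.
move=> uv FD ve.
have u0 x : 0 <= u x by have /andP[] := uv x.
rewrite (@esum_fset_split D F)//.
have le : (\esum_(x in D `\` [set` F]) (u x)%:E <= e%:E)%E.
  by apply: le_trans ve; apply: le_esum => x _; rewrite lee_fin; have /andP[] := uv x.
have : (0 <= \esum_(x in D `\` [set` F]) (u x)%:E)%E.
  by apply: esum_ge0 => x _; rewrite lee_fin.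
move: le; case: (\esum_(x in _ `\` _) _)%E => [y||]//.
by rewrite !lee_fin /= => *; apply/andP; split; lra.
Qed.

(** The sums of the positive and negative parts each exceed their partial sums by an amount in
    [0, e], so their difference is off by at most e, not 2e. *)
Lemma rsum_approx D F f v e : (forall x, `|f x| <= v x) ->
  [set` F] `<=` D -> (\esum_(x in D `\` [set` F]) (v x)%:E <= e%:E)%E ->
  `|rsum D f - \sum_(x <- F) f x| <= e.
Proof.
move=> fv FD ve; rewrite /rsum.
have pos : forall x, 0 <= (f^\+ x) <= v x.
  move=> x; rewrite funrpos_ge0/= /funrpos; have := fv x.
  by rewrite ler_norml ge_max => /andP[? ?]; apply/andP; split; lra.
have neg : forall x, 0 <= (f^\- x) <= v x.
  move=> x; rewrite funrneg_ge0/= /funrneg; have := fv x.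
  by rewrite ler_norml ge_max => /andP[? ?]; apply/andP; split; lra.
have := @fine_esum_approx D F _ v e pos FD ve.
have := @fine_esum_approx D F _ v e neg FD ve.
have -> : \sum_(x <- F) f x = \sum_(x <- F) f^\+ x - \sum_(x <- F) f^\- x.
  by rewrite -sumrB; apply: eq_bigr => x _; rewrite -[in LHS](funrposBneg f).
by move=> /andP[? ?] /andP[? ?]; rewrite ler_norml; apply/andP; split; lra.
Qed.

Lemma ge0_esumZl D (c : R) u : 0 <= c -> (forall x, 0 <= u x) ->
  (\esum_(x in D) (c * u x)%:E = c%:E * \esum_(x in D) (u x)%:E)%E.
Proof.
have le (c' : R) u' : 0 <= c' -> (forall x, 0 <= u' x) ->
    (\esum_(x in D) (c' * u' x)%:E <= c'%:E * \esum_(x in D) (u' x)%:E)%E.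
  move=> c0 u0; apply: ge_ereal_sup => /= _ [X [finX XD] <-].
  rewrite fsbig_finite//= sumEFin -mulr_sumr EFinM lee_wpmul2l ?lee_fin//.
  by apply: esum_ge; exists X => //; rewrite fsbig_finite//= sumEFin.
rewrite le_eqVlt => /orP[/eqP <-|c0] u0.
  by rewrite mul0e esum1// => x _; rewrite mul0r.
apply/eqP; rewrite eq_le (le _ _ (ltW c0) u0)/=.
(* The reverse inequality is [le] for the scalar c^-1 and the family c u. *)
have := le c^-1 (fun x => c * u x); rewrite invr_ge0 ltW// => /(_ isT).
under eq_esum do rewrite mulKf ?gt_eqF//.
move=> /(_ (fun x => mulr_ge0 (ltW c0) (u0 x))) h.
apply: (le_trans (lee_wpmul2l _ h)); first by rewrite lee_fin ltW.
by rewrite muleA -EFinM mulfV ?gt_eqF// mul1e.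
Qed.

End esum_tails.

(** * Finite families of characters with vanishing averages *)

(* Characters are written exp(i alpha) with alpha : G -> R additive. *)
Section phases.
Context {R : realType} {T : choiceType}.
Local Notation G := {freeg T / int}.

(* The phase y is there for the induction: the family for g :: s consists of alpha
   and alpha + chi with chi g = pi. *)
Lemma separating_phases (s : seq G) : 0 \notin s ->
  exists (I : finType) (alpha : I -> {additive G -> R}), (0 < #|I|)%N /\
    forall g y, g \in s -> \sum_(i : I) cos (alpha i g + y) = 0.
Proof.
elim: s => [_|g s IH]; first by exists unit, (fun=> \0); rewrite card_unit.
rewrite inE negb_or eq_sym => /andP[g0 /IH[I [alpha [I0 kill]]]].
have [x gx] : exists x, coeff x g != 0.
  apply/not_existsP => h; move/eqP: g0; apply; apply/eqP/freeg_eqP => x.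
  by rewrite coeff0; apply/eqP/negPn/negP => /h.
(* The coordinate at [x] is scaled so that [chi g] is pi, a shift that flips the sign of the
   cosine. *)
pose chi (h : G) : R := pi / (coeff x g)%:~R * (coeff x h)%:~R.
have chi_add : additive chi by move=> u v; rewrite /chi coeffB rmorphB mulrBr.
pose chiA : {additive G -> R} := HB.pack chi (GRing.isZmodMorphism.Build _ _ chi chi_add).
have chig : chi g = pi by rewrite /chi divfK// intr_eq0.
pose beta i (b : bool) : {additive G -> R} :=
  if b then (alpha i \+ chiA : {additive G -> R}) else alpha i.
exists (I * bool)%type, (fun z => beta z.1 z.2); split.
  by rewrite card_prod card_bool muln_gt0 I0.
move=> h y; rewrite -(pair_bigA _ (fun i b => cos (beta i b h + y))) /=.
under eq_bigr do rewrite big_bool /=.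
(* For [g] the two halves cancel termwise. For an element of [s] each half vanishes by induction,
   the second one with [chi h] absorbed into the phase. *)
rewrite big_split/= inE => /orP[/eqP ->|hs].
  rewrite -big_split big1// => i _ /=.
  by rewrite chig addrAC cosDpi addNr.
rewrite kill// addr0.
by under eq_bigr do rewrite -addrA; exact: kill.
Qed.

End phases.

(** * Extraction of one coefficient by averaging over characters *)

Section averaging.
Context {R : realType} {T : choiceType}.
Local Notation G := {freeg T / int}.

(** The upper bound follows from exp(-x) (1 + x) <= 1 and (1 + x) (1 - x + x^2) = 1 + x^3 >= 1. *)
Lemma expR_taylor1 (x : R) : 0 <= x -> 0 <= expR (- x) - 1 + x <= x ^+ 2.
Proof.
move=> x0; have h1 := expR_ge1Dx (- x); have h2 := expR_ge1Dx x.
apply/andP; split; first lra.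
have e0 := expR_gt0 (- x).
have : expR (- x) * (1 + x) <= 1.
  by rewrite (le_trans (ler_wpM2l (ltW e0) h2))// -expRD addNr expR0.
nra.
Qed.

Lemma sum_pick (F : {fset G}) (f : G -> R) (x : G) : x \in F ->
  \sum_(k <- F) f k * (k == x)%:R = f x.
Proof.
move=> xF; rewrite (bigD1_seq x xF (fset_uniq F))/= eqxx mulr1 big1 ?addr0// => k /negbTE ->.
by rewrite mulr0.
Qed.

(* p and lam are only approximately given by their sums over F, with error e, so
   that infinite sums can be treated by truncation. *)
Lemma phase_average_estimate (F : {fset G}) (p nu : G -> R)
    (lam : {additive G -> R} -> R) (g : G) (t b e : R) :
  0 \in F -> g \in F -> - g \in F -> nu (- g) = nu g -> 0 <= t ->
  (forall alpha, 0 <= lam alpha <= b) ->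
  (forall alpha : {additive G -> R},
    `|\sum_(h <- F) p h * cos (alpha h) - expR (- (t * lam alpha))| <= e) ->
  (forall alpha : {additive G -> R}, `|\sum_(h <- F) p h * sin (alpha h)| <= e) ->
  (forall alpha : {additive G -> R},
    `|\sum_(k <- F | k != 0) nu k * (1 - cos (alpha k)) - lam alpha| <= e) ->
  `|p g - (if g == 0 then 1 - t * \sum_(k <- F | k != 0) nu k else t * nu g)|
    <= (t * b) ^+ 2 + 2 * e + t * e.
Proof.
move=> F0 gF NgF nug t0 lamb pcos psin nucos.
(* These are all the nonzero arguments at which averaged cosines occur below; on them the average
   [c] becomes a Kronecker delta. *)
pose s := [seq x <- g :: [seq h - g | h <- F] ++ [seq h + g | h <- F] | x != 0].
have [|I [alpha [I0 kill]]] := @separating_phases R T s.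
  by rewrite mem_filter eqxx.
pose n : R := #|I|%:R.
have n0 : n != 0 by rewrite pnatr_eq0 -lt0n.
pose c x := n^-1 * \sum_(i : I) cos (alpha i x).
have cE x : x \in g :: [seq h - g | h <- F] ++ [seq h + g | h <- F] -> c x = (x == 0)%:R.
  move=> xs; rewrite /c; have [x0|x0] := eqVneq x 0.
    rewrite x0 (eq_bigr (fun=> 1)) => [|i _]; last by rewrite raddf0 cos0.
    by rewrite sumr_const -/n mulVf.
  under eq_bigr do rewrite -[alpha _ x]addr0.
  by rewrite kill ?mulr0// mem_filter x0.
have cB h : h \in F -> c (h - g) = (h == g)%:R.
  move=> hF; rewrite cE ?subr_eq0// inE mem_cat.
  by rewrite (map_f (fun h => h - g))// orbT.
have cD h : h \in F -> c (h + g) = (h == - g)%:R.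
  move=> hF; rewrite cE ?addr_eq0// inE mem_cat.
  by rewrite (map_f (fun h => h + g))// !orbT.
(* This is the truncation of Re((hat p - 1 + t lambda) exp(i alpha(g))), rewritten by the addition
   formulas so that every cosine is linear in one argument and can be averaged. *)
pose Q i := \sum_(h <- F) p h * cos (alpha i (h - g)) - cos (alpha i g) +
  t * \sum_(k <- F | k != 0)
    nu k * (cos (alpha i g) - 2^-1 * (cos (alpha i (k + g)) + cos (alpha i (k - g)))).
have Qle i : `|Q i| <= (t * b) ^+ 2 + 2 * e + t * e.
  have := pcos (alpha i); have := psin (alpha i); have := nucos (alpha i).
  have /andP[l0 lb] := lamb (alpha i).
  set L := lam _; set S1 := \sum_(k <- F | _) _; set S2 := \sum_(h <- F) _ * sin _.
  set S3 := \sum_(h <- F) _ * cos _; set E := expR _ => h1 h2 h3.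
  (* Four errors appear: the truncated cosine and sine sums (e each), the Taylor remainder of the
     exponential ((t b)^2) and the truncated exponent (t e). *)
  have -> : Q i = (S3 - E) * cos (alpha i g) + S2 * sin (alpha i g) +
      (E - 1 + t * L) * cos (alpha i g) + t * (S1 - L) * cos (alpha i g).
    rewrite /Q.
    have -> : \sum_(h <- F) p h * cos (alpha i (h - g)) =
        S3 * cos (alpha i g) + S2 * sin (alpha i g).
      rewrite /S3 /S2 !mulr_suml -big_split; apply: eq_bigr => h _ /=.
      by rewrite raddfB cosB; ring.
    have -> : \sum_(k <- F | k != 0) nu k *
        (cos (alpha i g) - 2^-1 * (cos (alpha i (k + g)) + cos (alpha i (k - g)))) =
        S1 * cos (alpha i g).
      rewrite /S1 !mulr_suml; apply: eq_bigr => k _.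
      by rewrite raddfB raddfD cosB cosD; field.
    by ring.
  have cos1 (x y : R) (z : R) : `|x| <= y -> `|x * cos z| <= y.
    move=> xy; rewrite normrM (le_trans _ xy)// ler_piMr// ler_norml.
    by rewrite cos_geN1 cos_le1.
  have sin1 : `|S2 * sin (alpha i g)| <= e.
    rewrite normrM (le_trans _ h2)// ler_piMr// ler_norml.
    by rewrite sin_geN1 sin_le1.
  have tL : `|E - 1 + t * L| <= (t * b) ^+ 2.
    have tL0 : 0 <= t * L by rewrite mulr_ge0.
    have /andP[? h] := expR_taylor1 _ tL0.
    rewrite ger0_norm// (le_trans h)// ler_sqr ?nnegrE// ?ler_wpM2l//.
    by rewrite mulr_ge0// (le_trans l0).
  have tS : `|t * (S1 - L)| <= t * e by rewrite normrM ger0_norm// ler_wpM2l.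
  have := cos1 _ _ (alpha i g) h3; have := cos1 _ _ (alpha i g) tL.
  have := cos1 _ _ (alpha i g) tS; move: sin1.
  rewrite !ler_norml => /andP[? ?] /andP[? ?] /andP[? ?] /andP[? ?].
  by apply/andP; split; lra.
have avg : n^-1 * \sum_(i : I) Q i =
    p g - (if g == 0 then 1 - t * \sum_(k <- F | k != 0) nu k else t * nu g).
  have -> : n^-1 * \sum_(i : I) Q i = \sum_(h <- F) p h * c (h - g) - c g +
      t * \sum_(k <- F | k != 0) nu k * (c g - 2^-1 * (c (k + g) + c (k - g))).
    rewrite /Q big_split/= sumrB -mulr_sumr exchange_big/= mulrDr mulrBr.
    congr (_ - _ + _).
      rewrite mulr_sumr; apply: eq_bigr => h _.
      by rewrite -mulr_sumr /c; ring.
    rewrite exchange_big/= mulrCA; congr (_ * _).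
    rewrite mulr_sumr; apply: eq_bigr => k _.
    rewrite -mulr_sumr /c sumrB -mulr_sumr big_split/=; ring.
  under eq_big_seq do rewrite cB//.
  rewrite sum_pick//.
  have -> : \sum_(k <- F | k != 0) nu k * (c g - 2^-1 * (c (k + g) + c (k - g))) =
     \sum_(k <- F | k != 0) nu k * ((g == 0)%:R - 2^-1 * ((k == - g)%:R + (k == g)%:R)).
    rewrite big_seq_cond [RHS]big_seq_cond; apply: eq_bigr => k /andP[kF _].
    by rewrite cB// cD// cE// inE eqxx.
  (* If g = 0, the average of cos(alpha(g)) is 1, and neither delta contributes because k is
     nonzero. *)
  rewrite cE ?inE ?eqxx//; have [->|g0] := eqVneq g 0.
    rewrite oppr0 (eq_bigr nu); first by rewrite /=; ring.
    by move=> k /negbTE ->; rewrite /=; ring.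
  (* If g is nonzero, only k = g and k = -g survive, each giving half of [nu g] by symmetry. *)
  rewrite big_mkcond/=.
  pose nu' k := if k != 0 then nu k else 0.
  rewrite (eq_bigr (fun k => - 2^-1 * (nu' k * (k == - g)%:R + nu' k * (k == g)%:R))).
    rewrite -mulr_sumr big_split/= !sum_pick// /nu' oppr_eq0 g0 nug /=.
    by field.
  by move=> k _; rewrite /nu' /=; case: ifP => _; by field.
rewrite -avg normrM ger0_norm ?invr_ge0 ?ler0n// mulrC ler_pdivrMr ?lt0r ?n0 ?ler0n//.
rewrite (le_trans (ler_norm_sum _ _ _))// (le_trans (ler_sum _ (fun i _ => Qle i)))//.
by rewrite sumr_const -/n mulr_natr.
Qed.

End averaging.

(** * Small-time behaviour of the convolution semigroup *)

Section small_time.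
Context {R : realType} {X : metricType R} {A : set X}.
Local Notation K := (Kgrp A).
Implicit Types (H : set K) (nu : K -> {nonneg R}).

(** The phases live on the whole free group; their restrictions supply enough characters of [H]. *)
Definition phase_char (alpha : {additive {freeg (~` A) / int} -> R}) (g : K) : R[i] :=
  (cos (alpha g) +i* sin (alpha g))%C.

Lemma phase_char_is_character H alpha : is_character H (phase_char alpha).
Proof.
move=> g h _ _; split.
  rewrite /phase_char raddfD cosD sinD; apply/eqP.
  by rewrite eq_complex/= eqxx/= addrC.
by rewrite /phase_char normc_def/= cos2Dsin2 sqrtr1.
Qed.

Lemma levy_mass_fin H nu : (weighted nu (pierced H) < +oo)%E ->
  (fine (weighted nu (pierced H)))%:E = weighted nu (pierced H).
Proof. by move=> fin; rewrite fineK// ge0_fin_numE// measure_ge0. Qed.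

(** The averaging estimate applies with b = 2a, which bounds the exponent because 1 - cos <= 2. The
    truncation error is arbitrary, so it disappears, and the remaining bound does not depend on
    [g]. *)
Lemma small_time_estimate H (p : R -> K -> {nonneg R}) lambdaH nu :
  is_subgroup H -> (forall t : R, 0 <= t -> weighted (p t) setT = 1%E) ->
  is_exponent H p lambdaH -> is_levy_measure H lambdaH nu ->
  let a := fine (weighted nu (pierced H)) in
  forall (t : R) g, 0 <= t -> H g ->
  `|(p t g)%:num - (if g == 0 then 1 - t * a else t * (nu g)%:num)| <= (t * (2 * a)) ^+ 2.
Proof.
move=> [H0 HB] p1 expo [nufin nusym lamE] a t g t0 Hg.
have HN k : H k -> H (- k) by move=> Hk; rewrite -sub0r; apply: HB.
pose lam alpha := lambdaH (phase_char alpha).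
have lam_expo alpha := expo _ (phase_char_is_character H alpha).
have cos01 (x : R) : 0 <= 1 - cos x <= 2.
  by have := cos_geN1 x; have := cos_le1 x => ? ?; apply/andP; split; lra.
(* The weight 2 nu dominates (1 - cos) nu for every character simultaneously. *)
pose nu2 k := 2 * (nu k)%:num.
have nu2_ge0 k : 0 <= nu2 k by rewrite mulr_ge0.
have nu2E : (\esum_(k in pierced H) (nu2 k)%:E = (2 * a)%:E)%E.
  by rewrite ge0_esumZl// EFinM levy_mass_fin.
have nucos_le alpha k : 0 <= (1 - complex.Re (phase_char alpha k)) * (nu k)%:num <= nu2 k.
  have /andP[? ?] := cos01 (alpha k).
  by rewrite /nu2 /=; apply/andP; split; [rewrite mulr_ge0|rewrite ler_wpM2r].
have lam_bnd alpha : 0 <= lam alpha <= 2 * a.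
  rewrite (lam_expo alpha).1 /= -lee_fin -nu2E lamE; last exact: phase_char_is_character.
  by apply: le_esum => k _; rewrite lee_fin; have /andP[] := nucos_le alpha k.
apply/ler_addgt0Pr => e0 e0_gt0.
(* The total error will be 2e + t e from the averaging estimate, plus t e for replacing the
   truncated mass of [nu] by [a] when g = 0. *)
pose e : R := e0 / (2 + 2 * t).
have t2 : 2 + 2 * t != 0 by rewrite gt_eqF//; lra.
have e_gt0 : 0 < e by rewrite divr_gt0//; lra.
have pge0 k : 0 <= (p t k)%:num by [].
have pfin : (\esum_(k in H) (p t k)%:num%:E < +oo)%E.
  rewrite (le_lt_trans (le_esum_set setT _ _ pge0 (subsetT _)))//.
  by rewrite -[X in (X < _)%E]/(weighted (p t) setT) p1 ?ltry.
have [F1 F1H tail1] := esum_tail _ _ _ pge0 pfin e_gt0.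
have [F2 F2H tail2] : exists2 F : {fset K}, [set` F] `<=` pierced H &
    (\esum_(k in pierced H `\` [set` F]) (nu2 k)%:E <= e%:E)%E.
  by apply: esum_tail => //; rewrite nu2E ltry.
pose F := (F1 `|` F2 `|` [fset 0; g; - g])%fset.
have FH : [set` F] `<=` H.
  move=> k; rewrite /= !inE => /orP[/orP[/F1H//|/F2H[]//]|].
  by move=> /orP[/orP[]|] /eqP -> //; exact: HN.
pose F' := [fset k in F | k != 0]%fset.
have F'H : [set` F'] `<=` pierced H.
  move=> k kF'; have /andP[/FH Hk /eqP k0] : (k \in F) && (k != 0).
    by move: kF'; rewrite /= !inE.
  by split.
have tailF : (\esum_(k in H `\` [set` F]) (p t k)%:num%:E <= e%:E)%E.
  apply: le_trans tail1; apply: le_esum_set => // k [Hk kF]; split => // kF1.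
  by apply: kF; rewrite /= !inE; move: kF1 => /= ->.
have tailF' : (\esum_(k in pierced H `\` [set` F']) (nu2 k)%:E <= e%:E)%E.
  apply: le_trans tail2; apply: le_esum_set => // k [[Hk k0] kF]; split => // kF2.
  apply: kF; rewrite /= !inE /=; move: kF2 => /= ->; rewrite orbT/=.
  exact/eqP.
have sumF' f : \sum_(k <- F | k != 0) f k = \sum_(k <- F') f k :> R.
  by rewrite big_fset_condE.
have nu_approx : \sum_(k <- F') (nu k)%:num <= a <= \sum_(k <- F') (nu k)%:num + e.
  apply: (fine_esum_approx _ _ _ nu2) => // k.
  by rewrite /nu2 /=; have : 0 <= (nu k)%:num by []; lra.
have key : `|(p t g)%:num - (if g == 0 then 1 - t * \sum_(k <- F | k != 0) (nu k)%:num
    else t * (nu g)%:num)| <= (t * (2 * a)) ^+ 2 + 2 * e + t * e.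
  apply: (phase_average_estimate F (fun k => (p t k)%:num) (fun k => (nu k)%:num) lam) => //.
  - by rewrite !inE eqxx !orbT.
  - by rewrite !inE eqxx !orbT.
  - by rewrite !inE eqxx !orbT.
  - have [->|g0] := eqVneq g 0; first by rewrite oppr0.
    by rewrite nusym//; split => //; apply/eqP.
  - move=> alpha; have := (lam_expo alpha).2 t t0.
    rewrite /fourier /csum => /(congr1 (@complex.Re _)) /=; rewrite mulNr => <-.
    rewrite distrC; under [X in rsum _ X]eq_fun do rewrite mul0r subr0.
    apply: (rsum_approx _ _ _ (fun k => (p t k)%:num)) => // k /=.
    rewrite normrM ger0_norm// ler_piMr// ler_norml.
    by rewrite cos_geN1 cos_le1.
  - move=> alpha; have := (lam_expo alpha).2 t t0.
    rewrite /fourier /csum => /(congr1 (@complex.Im _)) /=.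
    under [X in rsum _ X]eq_fun do rewrite mul0r addr0 mulrN.
    (* The transform is real, so its imaginary part is 0 and the finite sine sum is a truncation of
       0. *)
    move=> im0; rewrite -normrN -sumrN -normrN -[X in `|X|]add0r -[X in `|X + _|]im0.
    apply: (rsum_approx _ _ _ (fun k => (p t k)%:num)) => // k /=.
    rewrite normrN normrM ger0_norm// ler_piMr// ler_norml.
    by rewrite sin_geN1 sin_le1.
  - move=> alpha; rewrite sumF' distrC ler_norml.
    have := fine_esum_approx _ F' _ nu2 e (nucos_le alpha) F'H tailF'.
    rewrite -lamE/=; last exact: phase_char_is_character.
    rewrite (eq_bigr (fun k => (nu k)%:num * (1 - cos (alpha k)))); last first.
      by move=> k _; rewrite mulrC.
    by move=> /andP[? ?]; apply/andP; split; rewrite /lam; lra.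
have eE : e0 = 2 * e + t * e + t * e :> R by rewrite /e; field; rewrite t2.
rewrite eE addrA addrA; case: ifP key => g0; rewrite ?sumF'.
  set S := \sum_(k <- F') _ in nu_approx *; move/andP: nu_approx => [n1 n2].
  have : t * S <= t * a by rewrite ler_wpM2l.
  have : t * a <= t * S + t * e by rewrite -mulrDr ler_wpM2l.
  by rewrite !ler_norml => ? ? /andP[? ?]; apply/andP; split; lra.
move=> /le_trans; apply.
by rewrite lerDl mulr_ge0// ltW.
Qed.

End small_time.

(** * Expectations of bounded subadditive functions along the semigroup *)

Section subadditive_expectation.
Context {R : realType} {X : metricType R} {A : set X}.
Local Notation K := (Kgrp A).

Lemma esum_exchange (S T : choiceType) (f : S -> T -> \bar R) :
  (forall x y, 0 <= f x y)%E ->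
  (\esum_(x in setT) \esum_(y in setT) f x y =
   \esum_(y in setT) \esum_(x in setT) f x y)%E.
Proof.
move=> f0; rewrite !esum_esum//.
rewrite (reindex_esum (setT `*`` (fun=> setT)) _ (fun z : T * S => (z.2, z.1)))//.
split => //= [[x y] [u v] _ _ [-> ->]//|[x y] _].
by exists (y, x).
Qed.

Context (p : R -> K -> {nonneg R}) (phi : K -> R).
Hypothesis conv : convolution_semigroup p.
Hypothesis phi01 : forall g, 0 <= phi g <= 1.
Hypothesis phi0 : phi 0 = 0.
Hypothesis phiD : forall g h, phi (g + h) <= phi g + phi h.

Let phi_ge0 g : 0 <= phi g. Proof. by have /andP[] := phi01 g. Qed.
Let phi_le1 g : phi g <= 1. Proof. by have /andP[] := phi01 g. Qed.
Let p_ge0 t g : 0 <= (p t g)%:num. Proof. by []. Qed.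
Let pphi_ge0 t g : 0 <= (p t g)%:num * phi g. Proof. exact: mulr_ge0. Qed.
Let p_mass t : 0 <= t -> (\esum_(g in setT) (p t g)%:num%:E = 1)%E.
Proof. by have [+ _ _] := conv; apply. Qed.

Definition expect t : R := fine (\esum_(g in setT) ((p t g)%:num * phi g)%:E)%E.

Lemma expectE t : 0 <= t ->
  (\esum_(g in setT) ((p t g)%:num * phi g)%:E = (expect t)%:E)%E.
Proof.
move=> t0; rewrite /expect fineK// ge0_fin_numE; last first.
  by apply: esum_ge0 => g _; rewrite lee_fin.
apply: (@le_lt_trans _ _ 1%E); last exact: ltry.
rewrite -(p_mass t t0); apply: le_esum => g _.
by rewrite lee_fin ler_piMr.
Qed.

(** Under the convolution the increment is h + k with independent h and k of laws p_s and p_t;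
    subadditivity separates the two, and each remaining factor has total mass 1. *)
Lemma expectD s t : 0 <= s -> 0 <= t -> expect (s + t) <= expect s + expect t.
Proof.
move=> s0 t0; rewrite -lee_fin EFinD -!expectE ?addr_ge0//.
have [_ _ convE] := conv.
have -> : (\esum_(g in setT) ((p (s + t) g)%:num * phi g)%:E =
    \esum_(g in setT) \esum_(h in setT)
      (phi g * ((p s h)%:num * (p t (g - h))%:num))%:E)%E.
  apply: eq_esum => g _; rewrite ge0_esumZl//.
  by rewrite -convE// mulrC.
rewrite esum_exchange; last by move=> g h; rewrite lee_fin !mulr_ge0.
apply: (@le_trans _ _ (\esum_(h in setT) ((p s h)%:num * phi h + expect t * (p s h)%:num)%:E)%E).
  apply: le_esum => h _.
  (* Substituting g = k + h turns [p t (g - h)] into [p t k]. *)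
  rewrite (reindex_esum setT setT (fun k => k + h)); last first.
    split => //= [u v _ _ /addIr//|u _]; by exists (u - h) => //; rewrite subrK.
  apply: (@le_trans _ _ (\esum_(k in setT)
     ((p s h)%:num * phi h * (p t k)%:num + (p s h)%:num * ((p t k)%:num * phi k))%:E)%E).
    apply: le_esum => k _; rewrite addrK lee_fin.
    have : 0 <= (p s h)%:num * (p t k)%:num by rewrite mulr_ge0.
    by have := phiD k h; nra.
  under eq_esum do rewrite EFinD.
  rewrite esumD; try by move=> k _; rewrite lee_fin !mulr_ge0.
  rewrite !ge0_esumZl ?mulr_ge0// p_mass// mule1 expectE// -EFinM -EFinD.
  by rewrite lee_fin [X in _ + X]mulrC.
have e0 : 0 <= expect t.
  by rewrite -lee_fin -expectE//; apply: esum_ge0 => k _; rewrite lee_fin.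
under eq_esum do rewrite EFinD.
rewrite esumD; try by move=> k _; rewrite lee_fin !mulr_ge0.
by rewrite ge0_esumZl// p_mass// mule1 !expectE.
Qed.

Lemma expect_divn t n : 0 <= t -> expect t <= n.+1%:R * expect (t / n.+1%:R).
Proof.
have mulS m s : 0 <= s -> expect (m.+1%:R * s) <= m.+1%:R * expect s.
  move=> s0; elim: m => [|m IH]; first by rewrite !mul1r.
  rewrite -[m.+2%:R]natr1 mulrDl mul1r (le_trans (expectD _ _ _ s0)) ?mulr_ge0//.
  by rewrite mulrDl mul1r lerD2r IH.
move=> t0; rewrite {1}(_ : t = n.+1%:R * (t / n.+1%:R)); first by rewrite mulS ?divr_ge0.
by rewrite mulrC divfK// pnatr_eq0.
Qed.

Context (H : set K) (nu : K -> {nonneg R}) (lambdaH : (K -> R[i]) -> R).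
Hypothesis subH : is_subgroup H.
Hypothesis expo : is_exponent H p lambdaH.
Hypothesis levy : is_levy_measure H lambdaH nu.

Let a := fine (weighted nu (pierced H)).

(** Take [F] carrying all but [e] of the mass of [nu]. On [F] the pointwise estimates are summed;
    outside [F] and 0, phi <= 1 leaves only the remaining mass of p_s, which is at most s e +
    O(s^2). Both [F] and [C] are independent of [s]. *)
Lemma expect_small_time (e : R) : 0 < e -> exists (F : {fset K}) (C : R),
  [set` F] `<=` pierced H /\ forall s, 0 <= s ->
    expect s <= s * (\sum_(g <- F) (nu g)%:num * phi g + e) + C * s ^+ 2.
Proof.
move=> e0; have [nufin _ _] := levy.
have nu_ge0 g : 0 <= (nu g)%:num by [].
have [F FH tail] := esum_tail _ _ _ nu_ge0 nufin e0.
have /andP[_ a_le] : \sum_(g <- F) (nu g)%:num <= a <= \sum_(g <- F) (nu g)%:num + e.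
  by apply: (fine_esum_approx _ _ _ (fun g => (nu g)%:num)) => // g; rewrite lexx andbT.
pose D := (2 * a) ^+ 2; pose N : R := (\sum_(g <- F) 1).
(* The error D s^2 is incurred N times in the sum of p_s phi over [F], N times in the mass of [F],
   and once at 0. *)
exists F, ((2 * N + 1) * D); split => // s s0.
have p1 : forall t : R, 0 <= t -> weighted (p t) setT = 1%E by have [] := conv.
have est := small_time_estimate H p lambdaH nu subH p1 expo levy s _ s0.
have [H0 _] := subH.
have F0 : 0 \notin F by apply/negP => /FH[_]; apply.
have est0 : 1 - s * a - D * s ^+ 2 <= (p s 0)%:num.
  have := est 0 H0; rewrite eqxx ler_norml -/a exprMn mulrC -/D => /andP[]; lra.
have estF g : g \in F ->
    s * (nu g)%:num - D * s ^+ 2 <= (p s g)%:num <= s * (nu g)%:num + D * s ^+ 2.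
  move=> gF; have /FH[Hg /eqP g0] := gF; have := est g Hg.
  rewrite (negbTE g0) ler_norml -/a exprMn mulrC -/D => /andP[? ?].
  by apply/andP; split; lra.
pose F' := (0 |` F)%fset.
have sumF' (u : K -> R) : \sum_(g <- F') u g = u 0 + \sum_(g <- F) u g.
  by rewrite big_fsetU1.
have splitp := esum_fset_split setT F' _ (p_ge0 s) (subsetT _).
have splitf := esum_fset_split setT F' _ (pphi_ge0 s) (subsetT _).
have tail_le : (\esum_(g in setT `\` [set` F']) ((p s g)%:num * phi g)%:E <=
    \esum_(g in setT `\` [set` F']) (p s g)%:num%:E)%E.
  by apply: le_esum => g _; rewrite lee_fin ler_piMr.
have total : expect s <= \sum_(g <- F) (p s g)%:num * phi g +
    (1 - (p s 0)%:num - \sum_(g <- F) (p s g)%:num).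
  move: splitp splitf; rewrite p_mass// expectE// !sumF' phi0 mulr0 add0r.
  move: tail_le; case: (\esum_(g in _) (p s g)%:num%:E)%E => [y||] //.
  case: (\esum_(g in _) _)%E => [z||] //.
  by rewrite -!EFinD lee_fin => ? [?] [->]; lra.
have sum1 : \sum_(g <- F) (p s g)%:num * phi g <=
    s * \sum_(g <- F) (nu g)%:num * phi g + N * (D * s ^+ 2).
  rewrite mulr_sumr /N mulr_suml -big_split/= big_seq [leRHS]big_seq.
  apply: ler_sum => g /estF /andP[_ h]; rewrite mul1r.
  have Ds : 0 <= D * s ^+ 2 by rewrite mulr_ge0// sqr_ge0.
  rewrite (le_trans (ler_wpM2r (phi_ge0 g) h))// mulrDl (mulrA s) lerD2l.
  by rewrite ler_piMr.
have sum2 : s * \sum_(g <- F) (nu g)%:num - N * (D * s ^+ 2) <= \sum_(g <- F) (p s g)%:num.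
  rewrite mulr_sumr /N mulr_suml -sumrB big_seq [leRHS]big_seq.
  by apply: ler_sum => g /estF /andP[h _]; rewrite mul1r.
have := ler_wpM2l s0 a_le; rewrite mulrDr.
clear splitp splitf tail_le tail nufin; move: total sum1 sum2 est0; rewrite -/a.
by lra.
Qed.

(** Cutting [0, t] into n + 1 equal pieces turns the quadratic error into C t^2 / (n + 1), while the
    linear term keeps its size. *)
Lemma expect_le_levy (t : R) : 0 <= t ->
  (\esum_(g in setT) ((p t g)%:num * phi g)%:E <=
   t%:E * \esum_(g in pierced H) ((nu g)%:num * phi g)%:E)%E.
Proof.
move=> t0; rewrite expectE//.
have nuphi_ge0 g : 0 <= (nu g)%:num * phi g by rewrite mulr_ge0.
have [nufin _ _] := levy.
have : (\esum_(g in pierced H) ((nu g)%:num * phi g)%:E <= a%:E)%E.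
  rewrite levy_mass_fin//; apply: le_esum => g _.
  by rewrite lee_fin ler_piMr.
have : (0 <= \esum_(g in pierced H) ((nu g)%:num * phi g)%:E)%E.
  by apply: esum_ge0 => g _; rewrite lee_fin.
case E : (\esum_(g in _) _)%E => [B||] // _ _; rewrite -EFinM lee_fin.
have sumB (F : {fset K}) : [set` F] `<=` pierced H -> \sum_(g <- F) (nu g)%:num * phi g <= B.
  move=> FH; rewrite -lee_fin -E; apply: esum_ge; exists [set` F] => //.
  by rewrite fsbig_finite//= set_fsetK sumEFin.
apply/ler_addgt0Pr => d d0.
(* Half of [d] pays for t e; the other half pays for the quadratic error once [n] is large. The
   order matters: [e] fixes [C], and [C] fixes [n]. *)
pose e := d / (2 * (t + 1)).
have e0 : 0 < e by rewrite divr_gt0//; lra.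
have te : t * e <= d / 2.
  have -> : e = (d / 2) / (t + 1) by rewrite /e; field; rewrite gt_eqF//; lra.
  by rewrite mulrA ler_pdivrMr; nra.
have [F [C [FH small]]] := expect_small_time e e0.
pose n := Num.truncn (2 * (`|C| * t ^+ 2) / d).
have nlt : 2 * (`|C| * t ^+ 2) / d < n.+1%:R by rewrite truncnS_gt.
apply: le_trans (expect_divn t n t0) _.
have s0 : 0 <= t / n.+1%:R by rewrite divr_ge0.
have n0 : 0 < n.+1%:R :> R by rewrite ltr0n.
apply: le_trans (ler_wpM2l (ltW n0) (small _ s0)) _.
set S := \sum_(g <- F) _.
have -> : n.+1%:R * (t / n.+1%:R * (S + e) + C * (t / n.+1%:R) ^+ 2) =
    t * S + t * e + C * t ^+ 2 / n.+1%:R by field; rewrite gt_eqF.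
have : t * S <= t * B by rewrite ler_wpM2l// sumB.
have : C * t ^+ 2 / n.+1%:R <= d / 2.
  rewrite ler_pdivrMr//; move: nlt; rewrite ltr_pdivrMr//.
  have : C * t ^+ 2 <= `|C| * t ^+ 2 by rewrite ler_wpM2r ?sqr_ge0 ?ler_norm.
  by lra.
by move=> h1 h2; rewrite (splitr d) addrA lerD// lerD.
Qed.

End subadditive_expectation.

(** * Subadditivity of the mass and its comparison with the metric *)

Section mass_and_rho.
Context {R : realType} {X : metricType R} {A : set X}.
Hypothesis A0 : A !=set0.
Local Notation K := (Kgrp A).
Implicit Types (g h : K) (f : (~` A) -> R).

Lemma eq_sum_support (I : eqType) (s1 s2 : seq I) (f : I -> R) :
  uniq s1 -> uniq s2 -> (forall i, f i != 0 -> (i \in s1) = (i \in s2)) ->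
  \sum_(i <- s1) f i = \sum_(i <- s2) f i.
Proof.
move=> u1 u2 s12; apply: perm_big_supp.
rewrite uniq_perm ?filter_uniq// => i; rewrite !mem_filter.
by case: eqP => //= /eqP; exact: s12.
Qed.

(** This lets the masses of several elements be summed over one common list. *)
Lemma mass_superset g (s : seq (~` A)) : uniq s -> {subset dom g <= s} ->
  mass g = \sum_(u <- s) `|coeff u g|%:~R * d1bar (Some u) None.
Proof.
move=> us gs; apply: eq_sum_support => // [|u]; first exact: uniq_dom.
rewrite mulf_eq0 negb_or intr_eq0 normr_eq0 => /andP[gu _].
by rewrite gs ?mem_dom// gu.
Qed.

Lemma mass0 : mass (0 : K) = 0.
Proof. by rewrite /mass big1// => u _; rewrite coeff0 normr0 mul0r. Qed.

Lemma mass_ge0 g : 0 <= mass g.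
Proof.
by apply: sumr_ge0 => u _; rewrite mulr_ge0 ?(d1bar_ge0 A0)// ler0z normr_ge0.
Qed.

Lemma massD g h : mass (g + h) <= mass g + mass h.
Proof.
pose s := undup (dom (g + h) ++ dom g ++ dom h).
rewrite !(@mass_superset _ s) ?undup_uniq//; do ?by
  move=> u us; rewrite mem_undup !mem_cat us ?orbT.
rewrite -big_split/=; apply: ler_sum => u _.
rewrite -mulrDl ler_wpM2r ?dist_to_ge0// -intrD ler_int coeffD.
exact: ler_normD.
Qed.

Lemma sum_enum_mset (a : Dmon A) (s : seq (~` A)) f :
  uniq s -> (forall x, (a x != 0)%N -> x \in s) ->
  \sum_(x <- enum_mset a) f x = \sum_(x <- s) (a x)%:R * f x.
Proof.
move=> us as_; rewrite -big_undup_iterop_count/=.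
rewrite (eq_bigr (fun x => (a x)%:R * f x)) => [|x _]; last first.
  rewrite -[in RHS](seq_mset_id a) mset_seqE mulr_natl.
  by rewrite Monoid.iteropE iter_addr_0.
apply: eq_sum_support => // [|x]; first exact: undup_uniq.
rewrite mulf_eq0 negb_or pnatr_eq0 => /andP[ax _].
rewrite mem_undup as_// -[X in X = _]/(x \in a) in_mset.
by rewrite lt0n.
Qed.

(** Matching every point of the positive and negative parts with the basepoint costs exactly the
    mass. *)
Lemma rho_le_mass g : rho g 0 <= mass g.
Proof.
rewrite /rho /W1 oppr0; set a := (_ `+` _)%mset; set b := (_ `+` _)%mset.
pose s := map (fun z => (Some z, None : quot A)) (enum_mset a) ++
          map (fun z => (None : quot A, Some z)) (enum_mset b).
have ms : matching a b s.
  rewrite /matching /s /unzip1 /unzip2 !map_cat -!map_comp !pmap_cat.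
  by rewrite !pmap_None !pmap_Some cats0 !seq_mset_id.
have p0 x : pos_part (0 : K) x = 0%N.
  by have := pos_partE (0 : K) x; rewrite coeff0 maxxx => -[].
have aE x : (a x)%:Z = Num.max (coeff x g) 0.
  by rewrite -pos_partE /a msetE2 p0 addn0.
have bE x : (b x)%:Z = Num.max (- coeff x g) 0.
  by rewrite -coeffN -pos_partE /b msetE2 p0.
apply: (@le_trans _ _ (\sum_(z <- s) d1bar z.1 z.2)).
  by apply: ge_inf; [exact: (W1_has_inf A0 a b).2 | exists s].
rewrite /s big_cat !big_map/=.
rewrite !(@sum_enum_mset _ (dom g)) ?uniq_dom//; last 2 first.
- by move=> x bx; rewrite mem_dom; apply/eqP => gx; have := bE x; rewrite gx; lia.
- by move=> x ax; rewrite mem_dom; apply/eqP => gx; have := aE x; rewrite gx; lia.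
rewrite -big_split/= /mass le_eqVlt; apply/orP; left; apply/eqP.
apply: eq_bigr => x _; rewrite -mulrDl -natrD; congr (_ * _).
have -> : `|coeff x g| = (a x + b x)%N%:Z by have := aE x; have := bE x; lia.
by [].
Qed.

End mass_and_rho.

(** * Finite sums as lower bounds for integrals on the discrete group *)

Section discrete_integral.
Context {R : realType} {X : metricType R} {A : set X}.
Local Notation K := (Kgrp A).

(** The integral over the disjoint singletons of [F] is the sum, and enlarging the domain to [D] can
    only increase it. *)
Lemma sum_le_integral_weighted (nu : K -> {nonneg R}) (D : set K) (f : K -> R)
    (F : {fset K}) : (forall k, 0 <= f k) -> [set` F] `<=` D ->
  ((\sum_(k <- F) f k * (nu k)%:num)%:E <= \int[weighted nu]_(k in D) (f k)%:E)%E.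
Proof.
move=> f0 FD.
have mf (B : set K) : measurable_fun B (EFin \o f) by move=> _ Y _.
apply: (@le_trans _ _ (\int[weighted nu]_(k in \big[setU/set0]_(k <- F) [set k]) (f k)%:E)%E).
  rewrite ge0_integral_bigsetU//; last 2 first.
  - by move=> i j _ _ [k [/= -> ->]].
  - by move=> i _; rewrite lee_fin.
  rewrite -sumEFin; apply: lee_sum => k _.
  rewrite (eq_integral (cst (f k)%:E)); last by move=> j; rewrite inE => ->.
  by rewrite integral_cst// [X in (_ <= _ * X)%E]esum_set1 ?lee_fin//.
apply: ge0_subset_integral => //; first by move=> k _; rewrite lee_fin.
by rewrite -bigcup_seq => k [j /= jF ->]; exact: FD.
Qed.

End discrete_integral.

(** * The tail bound for the process *)

Lemma Hgrp_subgroup (R : realType) (X : metricType R) (A : set X)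
  (p : R -> Kgrp A -> {nonneg R}) : is_subgroup (Hgrp p).
Proof.
split; first by move=> G [[G0 _] _].
by move=> g h Hg Hh G [subG sG]; apply: subG.2; [apply: Hg|apply: Hh].
Qed.

Theorem theorem16 (R : realType) (X : metricType R) (A : set X)
    (psi : R -> R)
    (p : R -> Kgrp A -> {nonneg R})
    (lambdaH : (Kgrp A -> R[i]%C) -> R)
    (nu : Kgrp A -> {nonneg R})
    (d : measure_display) (Omega : measurableType d)
    (P : probability Omega R) (Xt : R -> Omega -> Kgrp A)
    (hA : A !=set0)
    (hdiscr : uniformly_discrete A)
    (hpsi_ge0 : forall s : R, 0 <= s -> 0 <= psi s)
    (hpsi0 : psi 0 = 0)
    (hpsi_sum : (\esum_(z in [set z : ~` A * ~` A | z.1 != z.2])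
                   (psi (d1bar (Some z.1) (Some z.2)))%:E < +oo)%E)
    (hp : psi_semigroup psi p)
    (hlambda : is_exponent (Hgrp p) p lambdaH)
    (hnu : is_levy_measure (Hgrp p) lambdaH nu)
    (hX : levy_process P (Hgrp p) p Xt) :
  forall t r : R, 0 < t -> 0 < r ->
    let bound : \bar R :=
      (t%:E * weighted nu [set k | pierced (Hgrp p) k /\ (r < mass k)%R] +
       (t / r)%:E *
         \int[weighted nu]_(k in [set k | pierced (Hgrp p) k /\ (mass k <= r)%R])
           (mass k)%:E)%E in
    (P [set w | (r < mass (Xt t w))%R] <= bound)%E /\
    (P [set w | (r < rho (Xt t w) 0)%R] <= bound)%E.
Proof.
move=> t r t0 r0 bound.
have t_ge0 := ltW t0.
have [conv _] := hp; have [_ _ _ [_ _ law]] := hX.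
have mass_pos := @mass_ge0 _ _ _ hA.
pose phi (g : Kgrp A) := Num.min 1 (mass g / r).
have phi01 g : 0 <= phi g <= 1.
  by rewrite /phi le_min ler01 divr_ge0 ?(ltW r0)//= ge_min lexx.
have phi0 : phi 0 = 0 by rewrite /phi mass0 mul0r min_r.
have phiD g h : phi (g + h) <= phi g + phi h.
  have ri : 0 < r^-1 by rewrite invr_gt0.
  have : mass (g + h) / r <= mass g / r + mass h / r by rewrite -mulrDl ler_pM2r// massD.
  have : 0 <= mass g / r by rewrite pmulr_lge0.
  have : 0 <= mass h / r by rewrite pmulr_lge0.
  rewrite /phi; set x := mass (g + h) / r; set y := mass g / r; set z := mass h / r.
  by case: (leP 1 x) => ?; case: (leP 1 y) => ?; case: (leP 1 z) => ?; lra.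
have main : (weighted (p t) [set g | (r < mass g)%R] <= bound)%E.
  (* As in Markov's inequality, [phi] is 1 where the mass exceeds [r] and nonnegative elsewhere. *)
  apply: (@le_trans _ _ (\esum_(g in setT) ((p t g)%:num * phi g)%:E)%E).
    apply: (@le_trans _ _ (\esum_(g in [set g | (r < mass g)%R]) ((p t g)%:num * phi g)%:E)%E).
      apply: le_esum => g /= rg; rewrite lee_fin /phi min_l ?mulr1//.
      by rewrite ler_pdivlMr// mul1r ltW.
    apply: le_esum_set => // g; rewrite mulr_ge0//.
    by have /andP[] := phi01 g.
  have levy_bound := expect_le_levy p phi conv phi01 phi0 phiD _ nu lambdaH
    (Hgrp_subgroup _ _ _ p) hlambda hnu t t_ge0.
  apply: le_trans levy_bound _.
  have nuphi_ge0 g : 0 <= (nu g)%:num * phi g.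
    by rewrite mulr_ge0//; have /andP[] := phi01 g.
  rewrite -ge0_esumZl//; apply: ge_ereal_sup => _ [Y [finY YH] <-].
  rewrite fsbig_finite//= sumEFin.
  set F := fset_set Y.
  have FH : [set` F] `<=` pierced (Hgrp p) by rewrite fset_setK.
  (* Each finite partial sum is split at mass [r]: above it phi <= 1 gives the first term of the
     bound, below it phi = mass / r gives the second. *)
  rewrite (bigID (fun g => r < mass g))/= EFinD; apply: leeD.
    rewrite big_fset_condE/=.
    apply: (@le_trans _ _ (\sum_(g <- [fset x in F | (r < mass x)%R]%fset) t * (nu g)%:num)%:E).
      rewrite lee_fin; apply: ler_sum => g _; rewrite ler_wpM2l// ler_piMr//.
      by have /andP[] := phi01 g.
    rewrite -mulr_sumr EFinM lee_wpmul2l ?lee_fin//.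
    apply: esum_ge; exists [set` [fset x in F | (r < mass x)%R]%fset].
      split => // g; rewrite /= !inE /= => /andP[gF rg]; split => //.
      exact: FH.
    by rewrite fsbig_finite//= set_fsetK sumEFin.
  rewrite big_fset_condE/=.
  rewrite (_ : (\sum_(g <- _) _)%:E = (t / r)%:E *
      (\sum_(g <- [fset x in F | ~~ (r < mass x)%R]%fset) mass g * (nu g)%:num)%:E)%E.
    rewrite lee_wpmul2l ?lee_fin ?divr_ge0 ?(ltW r0)//.
    apply: sum_le_integral_weighted => // g; rewrite /= !inE /= -leNgt => /andP[gF rg].
    by split => //; exact: FH.
  rewrite -EFinM mulr_sumr; congr EFin; rewrite big_seq [RHS]big_seq.
  apply: eq_bigr => g; rewrite !inE /= -leNgt => /andP[_ gr].
  rewrite /phi min_r; first by field; rewrite gt_eqF.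
  by rewrite ler_pdivrMr// mul1r.
split; first by rewrite -[X in P X]/(Xt t @^-1` [set g | (r < mass g)%R]) law.
rewrite -[X in P X]/(Xt t @^-1` [set g | r < rho g 0]) law//.
(* Since rho is at most the mass, the event for rho is contained in the event for the mass. *)
apply: le_trans main; apply: le_esum_set => // g /= rg.
exact: lt_le_trans rg (rho_le_mass hA g).
Qed.
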